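(* Let $D=\{x\in\mathbf{R}^2:\|x\|\le 1\}$ be the closed unit disk. Let $\gamma\colon[0,\infty)\to\mathbf{R}^2$ be any path (in the sense defined in the context), and let $\ell\colon[0,\infty)\to\mathbf{R}^2$ be a straight line path, $\ell(s)=su$ for a fixed unit vector $u\in\mathbf{R}^2$. Let $X$ be a random variable uniformly distributed in $D$. Then the expected escape times satisfy \[ J(\gamma)\ge J(\ell), \] where for a path $\eta$ we set $J(\eta)=\mathbb{E}[T_\eta(X)]$ and $T_\eta(x)=\inf\{t\ge 0: x+\eta(t)\notin \operatorname{int}(D)\}$ (with $\inf\emptyset=\infty$).
   Context: $\|\cdot\|$ is the Euclidean norm. A path is a continuous curve $\gamma\colon[0,\infty)\to\mathbf{R}^2$ with $\gamma(0)=0$ that is arc-length parametrised: for every $t>0$, the length of the curve from $\gamma(0)$ to $\gamma(t)$ is exactly $t$ (corners are allowed, e.g. polygonal chains). The escape time $T_\gamma(x)$ from a starting point $x\in D$ is the first time $t\ge0$ at which $x+\gamma(t)$ leaves the interior of $D$, defined to be $\infty$ if this never happens. The expected escape time is $J(\gamma)=\mathbb{E}[T_\gamma(X)]$ with $X$ uniform in $D$. *)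

(* Defs.v *)
From HB Require Import structures.
From mathcomp Require Import all_boot all_order all_algebra.
From mathcomp Require Import all_classical all_reals all_analysis.
Set Implicit Arguments. Unset Strict Implicit. Unset Printing Implicit Defensive.
Import Order.TTheory GRing.Theory Num.Theory.
Local Open Scope classical_set_scope.
Local Open Scope ring_scope.

Section Defs.
Variable R : realType.

Definition enorm2 (p : R * R) : R := Num.sqrt (p.1 ^+ 2 + p.2 ^+ 2).

Definition vsub (p q : R * R) : R * R := (p.1 - q.1, p.2 - q.2).
Definition vadd (p q : R * R) : R * R := (p.1 + q.1, p.2 + q.2).

Definition disk : set (R * R) := [set x | enorm2 x <= 1].
Definition open_disk : set (R * R) := [set x | enorm2 x < 1].

Definition curve_length (g : R -> R * R) (a b : R) : \bar R :=
  ereal_sup [set l : \bar R | exists (n : nat) (s : nat -> R),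
      [/\ s 0%N = a, s n = b, (forall i, (i < n)%N -> s i <= s i.+1) &
           l = (\sum_(i < n) enorm2 (vsub (g (s i.+1)) (g (s i))))%:E]].

Definition is_path (g : R -> R * R) : Prop :=
  [/\ g 0 = (0, 0),
      (forall t, 0 <= t -> forall e, 0 < e -> exists2 d, 0 < d &
          forall s, 0 <= s -> `|s - t| < d -> enorm2 (vsub (g s) (g t)) < e)
    & forall t, 0 < t -> curve_length g 0 t = t%:E].

(* escape time: inf of times t >= 0 with x + g t outside int D (inf set0 = +oo) *)
Definition escape_time (g : R -> R * R) (x : R * R) : \bar R :=
  ereal_inf [set t%:E | t in [set t : R | 0 <= t /\ ~ open_disk (vadd x (g t))]].

Definition leb2 := (@lebesgue_measure R \x @lebesgue_measure R)%E.

(* expected escape time for X uniform in D (density 1/pi on D) *)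
Definition expected_escape (g : R -> R * R) : \bar R :=
  ((pi^-1)%:E * \int[leb2]_(x in disk) escape_time g x)%E.

Definition straight_path (u : R * R) : R -> R * R := fun s => (s * u.1, s * u.2).

End Defs.

(* Main.v *)
Require Import Defs.
From HB Require Import structures.
From mathcomp Require Import all_boot all_order all_algebra.
From mathcomp Require Import all_classical all_reals all_analysis.
From mathcomp Require Import measurable_realfun ring lra.
Import Order.TTheory GRing.Theory Num.Theory.
Set Implicit Arguments. Unset Strict Implicit. Unset Printing Implicit Defensive.
Local Open Scope classical_set_scope.
Local Open Scope ring_scope.

(** The starting points that have not escaped by time t form the intersection
    K(t) of the unit disks centred at the points - g s with s <= t, and the
    expectation is the integral of the area of K(t) over t, up to the factor
    1/pi.  For the straight path K(t) is the lens of two disks whose centres are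
    at distance t; let L(t) be its area and h(t) = sqrt (4 - t^2) its height, so
    that L' = - h.  It is enough to show that K(t) has area at least L(t).

    Moving the last disk by a vector v removes from K a region that meets each
    line parallel to v in a set of length at most |v|, hence an area at most
    |v| diam K.  Conversely an intersection of unit disks that contains p and q
    contains the whole lens with corners p and q, so the area of K is at least
    L(h (diam K)), where h is an involution.  Thus area K(t) satisfies the
    differential inequality A' >= - h (L^-1 A), whose equality case is L.

    For finitely many sample times the comparison is made with a path slowed by a
    factor 1 + k, which absorbs the second order errors; disks of radius r < 1
    absorb the motion between sample times.  *)

(** * Area-preserving maps *)

Section Invariance.
Variable R : realType.
Notation mu := (@leb2 R).

Lemma lebesgue_measure_translation (c : R) (A : set (measurableTypeR R)) :
  measurable A -> lebesgue_measure [set x : R | A (x + c)] = lebesgue_measure A.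
Proof.
move=> mA.
pose f : measurableTypeR R -> measurableTypeR R := fun x => x + c.
have mf : measurable_fun [set: measurableTypeR R] f by exact: measurable_funD.
rewrite -[LHS]/(pushforward lebesgue_measure f A).
apply/esym/lebesgue_measure_unique => //= X [[a b]/= _ <-].
rewrite /pushforward /preimage/= /f.
have -> : [set x : R | x + c \in `]a, b]] = `]a - c, b - c]%classic.
  by apply/seteqP; split => x /=; rewrite !in_itv/= ltrBlDr lerBrDr.
by rewrite !lebesgue_measure_itv/= !lte_fin ltrD2r -!EFinB opprB addrA subrK.
Qed.

Lemma lebesgue_measure_bounded_itv (x y : bool) (a b : R) : a <= b ->
  lebesgue_measure [set` Interval (BSide x a) (BSide y b)] = (b - a)%:E.
Proof.
rewrite le_eqVlt lebesgue_measure_itv/= lte_fin => /orP[/eqP->|->].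
  by rewrite ltxx subrr.
by rewrite EFinB.
Qed.

(** The iterated integral in the other order, so that horizontal shears can be checked on horizontal
    sections. *)
Lemma leb2E2 (A : set (R * R)) : measurable A ->
  mu A = (lebesgue_measure \x^ lebesgue_measure)%E A.
Proof.
move=> mA; rewrite /leb2.
apply: (@product_measure_unique _ _ _ _ R lebesgue_measure lebesgue_measure) => //.
by move=> X Y mX mY; apply: product_measure2E.
Qed.

Definition preserves_area (f : R * R -> R * R) :=
  forall A, measurable A -> measurable (f @^-1` A) /\ mu (f @^-1` A) = mu A.

Lemma preserves_area_comp f g :
  preserves_area f -> preserves_area g -> preserves_area (f \o g).
Proof.
move=> hf hg A mA; have [mf <-] := hf _ mA.
by have [mgf <-] := hg _ mf.
Qed.

Lemma preserves_area_shear1 (h : R -> R) : measurable_fun setT h ->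
  preserves_area (fun p => (p.1 + h p.2, p.2)).
Proof.
move=> mh A mA.
have mf : measurable_fun setT (fun p : R * R => (p.1 + h p.2, p.2)).
  apply/measurable_fun_pair => //=; apply: measurable_funD => //.
  exact: measurableT_comp.
have mfA : measurable ((fun p : R * R => (p.1 + h p.2, p.2)) @^-1` A).
  by rewrite -[X in measurable X]setTI; exact: mf.
split => //; rewrite !leb2E2//; apply: eq_integral => y _ /=.
rewrite -[RHS](lebesgue_measure_translation (h y)); last exact: measurable_ysection.
by congr (lebesgue_measure _); apply/seteqP; split => x /=; rewrite /ysection /= !inE.
Qed.

Lemma preserves_area_shear2 (h : R -> R) : measurable_fun setT h ->
  preserves_area (fun p => (p.1, p.2 + h p.1)).
Proof.
move=> mh A mA.
have mf : measurable_fun setT (fun p : R * R => (p.1, p.2 + h p.1)).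
  apply/measurable_fun_pair => //=; apply: measurable_funD => //.
  exact: measurableT_comp.
have mfA : measurable ((fun p : R * R => (p.1, p.2 + h p.1)) @^-1` A).
  by rewrite -[X in measurable X]setTI; exact: mf.
split => //; rewrite /leb2; apply: eq_integral => x _ /=.
rewrite -[RHS](lebesgue_measure_translation (h x)); last exact: measurable_xsection.
by congr (lebesgue_measure _); apply/seteqP; split => y /=; rewrite /xsection /= !inE.
Qed.

(** In complex notation, p goes to m + u p: for a unit vector u, a rotation followed by a
    translation. *)
Definition rigid (m u : R * R) (p : R * R) : R * R :=
  (m.1 + u.1 * p.1 - u.2 * p.2, m.2 + u.2 * p.1 + u.1 * p.2).

Lemma preserves_area_rigid m u : u.1 ^+ 2 + u.2 ^+ 2 = 1 ->
  preserves_area (rigid m u).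
Proof.
case: m u => m1 m2 [c s] /= cs1.
have mM (k : R) : measurable_fun setT ( *%R k) by exact: measurable_funM.
(* a rotation by an angle other than pi is a product of three shears *)
have half (d e : R) : d ^+ 2 + e ^+ 2 = 1 -> d != -1 ->
    preserves_area (rigid (0, 0) (d, e)).
  move=> de1 dN1; have d1 : 1 + d != 0 by rewrite addrC -[1]opprK subr_eq0.
  have S1 := preserves_area_shear1 (mM (- (e / (1 + d)))).
  have S2 := preserves_area_shear2 (mM e).
  have := preserves_area_comp S1 (preserves_area_comp S2 S1).
  congr preserves_area; apply/funext => -[x y]; rewrite /rigid /=.
  set k := e / (1 + d).
  have k1 : k * (1 + d) = e by rewrite /k divfK.
  have ek : e * k = 1 - d.
    apply: (mulfI d1); rewrite /k; transitivity (e ^+ 2); first by field.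
    by rewrite -[1 in RHS]de1; move: de1; nra.
  congr pair.
    transitivity (x * (1 - e * k) - y * (k * (2 - e * k))); first ring.
    by rewrite ek (_ : 2 - (1 - d) = 1 + d) ?k1; ring.
  transitivity (e * x + y * (1 - e * k)); first ring.
  by rewrite ek; ring.
have rot : preserves_area (rigid (0, 0) (c, s)).
  have [cN1|/half] := eqVneq c (-1); last exact.
  have s0 : s = 0.
    by apply/eqP; rewrite -sqrf_eq0; apply/eqP; move: cs1; rewrite cN1; lra.
  have h01 : preserves_area (rigid (0, 0) (0, 1)).
    by apply: half; [lra|apply/eqP; lra].
  have := preserves_area_comp h01 h01; congr preserves_area.
  by apply/funext => -[x y]; rewrite /rigid /= cN1 s0; congr pair; ring.
have T1 := preserves_area_shear1 (measurable_cst m1 : measurable_fun setT (fun=> m1)).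
have T2 := preserves_area_shear2 (measurable_cst m2 : measurable_fun setT (fun=> m2)).
have := preserves_area_comp (preserves_area_comp T1 T2) rot; congr preserves_area.
by apply/funext => -[x y]; rewrite /rigid /=; congr pair; ring.
Qed.
End Invariance.

(** * Lenses *)

Section Lens.
Variable R : realType.
Notation mu := (@leb2 R).
Implicit Types (c p q m u : R * R) (r t d : R).

Definition cball c r : set (R * R) :=
  [set p | (p.1 - c.1) ^+ 2 + (p.2 - c.2) ^+ 2 <= r ^+ 2].

(** For t >= 0, the common part of the disks centred at (t/2, 0) and (- t/2, 0); the absolute value
    selects the farther centre. *)
Definition lens r t : set (R * R) :=
  [set p | (`|p.1| + t / 2) ^+ 2 + p.2 ^+ 2 <= r ^+ 2].

Lemma measurable_cball c r : measurable (cball c r).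
Proof.
have mf : measurable_fun setT (fun p : R * R => (p.1 - c.1) ^+ 2 + (p.2 - c.2) ^+ 2).
  by apply: measurable_funD; apply: measurable_funX; apply: measurable_funB.
have -> : cball c r = setT `&`
    (fun p : R * R => (p.1 - c.1) ^+ 2 + (p.2 - c.2) ^+ 2) @^-1` `]-oo, r ^+ 2].
  by rewrite setTI; apply/seteqP; split => p; rewrite /= in_itv.
exact: mf.
Qed.

Lemma lensE r t : 0 <= t -> lens r t = cball (t / 2, 0) r `&` cball (- (t / 2), 0) r.
Proof.
move=> t0; apply/seteqP; split => -[x y]; rewrite /lens /cball /=.
  by case: (ler0P x) => x0 h; split; nra.
by case: (ler0P x) => x0 []; nra.
Qed.

Lemma measurable_lens r t : 0 <= t -> measurable (lens r t).
Proof. by move=> t0; rewrite lensE//; apply: measurableI; apply: measurable_cball. Qed.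

Definition along u t m : R * R := (m.1 + t * u.1, m.2 + t * u.2).

Lemma measure_cballI m u r t : 0 <= t -> u.1 ^+ 2 + u.2 ^+ 2 = 1 ->
  mu (cball m r `&` cball (along u t m) r) = mu (lens r t).
Proof.
move=> t0 u1.
have mI : measurable (cball m r `&` cball (along u t m) r).
  by apply: measurableI; apply: measurable_cball.
have [_ <-] := preserves_area_rigid (along u (t / 2) m) u1 mI.
congr (mu _); rewrite lensE// setIC.
move: u1; case: u {mI} => a b /= ab1.
have E (x y : R) : (a * x - b * y) ^+ 2 + (b * x + a * y) ^+ 2 = x ^+ 2 + y ^+ 2.
  by rewrite -[RHS]mul1r -ab1; ring.
have E1 x y : (m.1 + t / 2 * a + a * x - b * y - m.1) ^+ 2 +
    (m.2 + t / 2 * b + b * x + a * y - m.2) ^+ 2 = (x - - (t / 2)) ^+ 2 + (y - 0) ^+ 2.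
  by rewrite -[RHS]E; ring.
have E2 x y : (m.1 + t / 2 * a + a * x - b * y - (m.1 + t * a)) ^+ 2 +
    (m.2 + t / 2 * b + b * x + a * y - (m.2 + t * b)) ^+ 2 =
    (x - t / 2) ^+ 2 + (y - 0) ^+ 2.
  by rewrite -[RHS]E; field.
by apply/seteqP; split => -[x y]; rewrite /cball /along /rigid /= E1 E2.
Qed.

(** A horizontal shear straightens this curved strip to the rectangle of sides X and Y. *)
Lemma measure_strip (h : R -> R) (X Y : set R) : measurable_fun setT h ->
  measurable X -> measurable Y ->
  measurable [set p : R * R | X (p.1 - h p.2) /\ Y p.2] /\
  mu [set p : R * R | X (p.1 - h p.2) /\ Y p.2] =
  (lebesgue_measure X * lebesgue_measure Y)%E.
Proof.
move=> mh mX mY; have mh' : measurable_fun setT (fun y => - h y).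
  by apply: measurableT_comp.
have := preserves_area_shear1 mh' (measurableX mX mY).
by rewrite /leb2 product_measure1E.
Qed.

(** Distance between the corners of [lens r t]. On [0, 2 r] it is an involution, exchanging this
    distance with that of the centres. *)
Definition lens_height r t := Num.sqrt (4 * r ^+ 2 - t ^+ 2).

Lemma mu_lens_le r t t' : 0 <= t -> t <= t' -> (mu (lens r t') <= mu (lens r t))%E.
Proof.
move=> t0 tt'.
apply: le_measure; rewrite ?inE; try by apply: measurable_lens; lra.
move=> -[x y]; rewrite /lens /=; have := normr_ge0 x; nra.
Qed.

Lemma measurable_sqrt_disk r :
  measurable_fun setT (fun y : R => Num.sqrt (r ^+ 2 - y ^+ 2)).
Proof.
apply: (@measurableT_comp _ _ _ _ _ _ (@Num.sqrt R)).
  by apply: continuous_measurable_fun; exact: sqrt_continuous.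
by apply: measurable_funB => //; apply: measurable_funX.
Qed.

(* The y-sections of the lens B(0) /\ B(-t e1) are the intervals
   [- f y, f y - t] with f y = sqrt (r^2 - y^2). *)
Lemma mu_lens_gap r t d : 0 <= r -> 0 <= t -> 0 <= d -> t + d <= 2 * r ->
  (mu (lens r (t + d)) + (d * lens_height r (t + d))%:E <= mu (lens r t))%E.
Proof.
move=> r0 t0 d0 tdr.
set H := lens_height r (t + d).
have H0 : 0 <= H by exact: sqrtr_ge0.
have H2 : H ^+ 2 = 4 * r ^+ 2 - (t + d) ^+ 2 by rewrite sqr_sqrtr//; nra.
have td0 : 0 <= t + d by lra.
have u1 : ((-1 : R), (0 : R)).1 ^+ 2 + ((-1 : R), (0 : R)).2 ^+ 2 = 1.
  by rewrite /=; ring.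
rewrite -(measure_cballI (0, 0) r td0 u1) -(measure_cballI (0, 0) r t0 u1).
set C := cball _ r; rewrite /along /=.
set A := cball (_, _) r; set B := cball (_, _) r.
(* For |y| <= H / 2, the section of S is the last piece, of length d, of the section of the larger
   lens. It is open on the left so that S misses the smaller lens. *)
have [mS] := measure_strip (measurable_sqrt_disk r)
  (measurable_itv `](- t - d), (- t)]) (measurable_itv `[(- (H / 2)), (H / 2)]).
set S := [set p | _] in mS *.
rewrite [X in (X * _)%E]lebesgue_measure_bounded_itv; last lra.
rewrite [X in (_ * X)%E]lebesgue_measure_bounded_itv; last lra.
have -> : ((- t - (- t - d))%:E * (H / 2 - - (H / 2))%:E = (d * H)%:E)%E.
  by rewrite -EFinM; congr (_%:E); field.
move=> muS.
have mC c : measurable (cball c r) by apply: measurable_cball.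
have mCA : measurable (C `&` A) by apply: measurableI; exact: mC.
have mCB : measurable (C `&` B) by apply: measurableI; exact: mC.
have CAS : C `&` A `&` S = set0.
  rewrite -subset0 => -[x y] [[]].
  rewrite /C /A /S /cball /= !in_itv/= => h1 h2 [] /andP[h3 h4] /andP[h5 h6].
  have f0 := sqrtr_ge0 (r ^+ 2 - y ^+ 2).
  have f2 : Num.sqrt (r ^+ 2 - y ^+ 2) ^+ 2 = r ^+ 2 - y ^+ 2.
    by rewrite sqr_sqrtr//; nra.
  nra.
rewrite -muS -measureU//.
apply: le_measure; rewrite ?inE//; first exact: measurableU.
move=> -[x y] [[]|]; rewrite /C /A /B /S /cball /= ?in_itv/=.
  by move=> h1 h2; split => //; have [xt|xt] := lerP 0 (x + t); nra.
move=> [] /andP[h3 h4] /andP[h5 h6].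
have f0 := sqrtr_ge0 (r ^+ 2 - y ^+ 2).
have y2 : y ^+ 2 <= r ^+ 2 - (t + d) ^+ 2 / 4 by nra.
have f2 : Num.sqrt (r ^+ 2 - y ^+ 2) ^+ 2 = r ^+ 2 - y ^+ 2.
  by rewrite sqr_sqrtr//; nra.
(* This keeps the piece to the right of the left end - f y of the section. *)
have ftd : (t + d) / 2 <= Num.sqrt (r ^+ 2 - y ^+ 2).
  by rewrite -(ler_pXn2r (_ : 0 < 2)%N) ?nnegrE ?f2 //; [nra|lra].
set F := Num.sqrt _ in h3 h4 f0 f2 ftd *.
have sq z : - F <= z -> z <= F -> z ^+ 2 <= r ^+ 2 - y ^+ 2 by rewrite -f2; nra.
have := sq x; have := sq (x + t).
by move=> s1 s2; split; rewrite -lerBrDr; [rewrite subr0 subr0; apply: s2|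
  rewrite !(mulr0, addr0, subr0) mulrN1 add0r opprK; apply: s1]; lra.
Qed.
End Lens.

(** * Intersections of disks of a common radius *)

Section Step.
Variable R : realType.
Notation mu := (@leb2 R).
Implicit Types (c p q m u : R * R) (r t d : R).

Lemma polar (v : R * R) : exists u,
  u.1 ^+ 2 + u.2 ^+ 2 = 1 /\ v = (enorm2 v * u.1, enorm2 v * u.2).
Proof.
case: v => a b; have s2 : enorm2 (a, b) ^+ 2 = a ^+ 2 + b ^+ 2.
  by rewrite sqr_sqrtr//= addr_ge0// sqr_ge0.
have [s0|s0] := eqVneq (enorm2 (a, b)) 0.
  exists (1, 0) => /=; split; first ring.
  have {}s2 : a ^+ 2 + b ^+ 2 = 0 by rewrite -s2 s0 expr0n.
  rewrite s0 !mul0r; congr pair; nra.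
exists (a / enorm2 (a, b), b / enorm2 (a, b)) => /=; split.
  by rewrite !expr_div_n -mulrDl -s2 divff// expf_neq0.
by rewrite ![enorm2 _ * (_ / _)]mulrC !divfK.
Qed.

(** The centre (C, E) is within r of the corners (-d/2, 0) and (d/2, 0), and (X, Y) lies in the lens
    with these corners. Adding the sharper inequality of each pair leaves room d |C| + t |Y|, which
    absorbs the cross terms - 2 X C - 2 Y E because |X| <= d / 2 and |E| <= t / 2. *)
Lemma spindle_coord (r t d X Y C E : R) : 0 <= t -> 0 <= d ->
  4 * r ^+ 2 = d ^+ 2 + t ^+ 2 ->
  (C + d / 2) ^+ 2 + E ^+ 2 <= r ^+ 2 -> (C - d / 2) ^+ 2 + E ^+ 2 <= r ^+ 2 ->
  X ^+ 2 + (Y + t / 2) ^+ 2 <= r ^+ 2 -> X ^+ 2 + (Y - t / 2) ^+ 2 <= r ^+ 2 ->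
  (X - C) ^+ 2 + (Y - E) ^+ 2 <= r ^+ 2.
Proof.
move=> t0 d0 rdt c1 c2 x1 x2.
have Ccd : C ^+ 2 + d * `|C| + E ^+ 2 <= t ^+ 2 / 4.
  by have [C0|C0] := ger0P C; nra.
have Yyt : X ^+ 2 + Y ^+ 2 + t * `|Y| <= d ^+ 2 / 4.
  by have [Y0|Y0] := ger0P Y; nra.
have aC := normr_ge0 C; have aY := normr_ge0 Y.
have Xd : `|X| <= d / 2.
  rewrite -(ler_pXn2r (_ : 0 < 2)%N) ?nnegrE//; last lra.
  by rewrite real_normK ?num_real//; nra.
have Et : `|E| <= t / 2.
  rewrite -(ler_pXn2r (_ : 0 < 2)%N) ?nnegrE//; last lra.
  by rewrite real_normK ?num_real//; nra.
have XC : - (X * C) <= d / 2 * `|C|.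
  by rewrite (le_trans (ler_norm _))// normrN normrM ler_wpM2r.
have YE : - (Y * E) <= `|Y| * (t / 2).
  by rewrite (le_trans (ler_norm _))// normrN normrM ler_wpM2l.
nra.
Qed.

Lemma cball_rigid m u c r x : u.1 ^+ 2 + u.2 ^+ 2 = 1 ->
  cball (rigid m u c) r (rigid m u x) = cball c r x.
Proof.
case: u => a b /= ab; rewrite /cball /rigid /=; congr (is_true (_ <= _)).
by rewrite -[RHS]mul1r -ab; ring.
Qed.

Lemma rigid_surj m u x : u.1 ^+ 2 + u.2 ^+ 2 = 1 -> exists y, x = rigid m u y.
Proof.
case: u m x => a b [m1 m2] [x1 x2] /= ab.
exists (a * (x1 - m1) + b * (x2 - m2), a * (x2 - m2) - b * (x1 - m1)).
rewrite /rigid /=; congr pair.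
  transitivity (m1 + (a ^+ 2 + b ^+ 2) * (x1 - m1)); last by ring.
  by rewrite ab; ring.
transitivity (m2 + (a ^+ 2 + b ^+ 2) * (x2 - m2)); last by ring.
by rewrite ab; ring.
Qed.

(* The two circles of radius r through p and q bound the intersection of all
   balls of radius r containing both points. *)
Lemma spindle u p d r t : 0 <= t -> 0 <= d -> u.1 ^+ 2 + u.2 ^+ 2 = 1 ->
  4 * r ^+ 2 = d ^+ 2 + t ^+ 2 ->
  exists S, [/\ measurable S, mu S = mu (lens r t) &
    forall c, cball c r p -> cball c r (along u d p) -> S `<=` cball c r].
Proof.
move=> t0 d0 u1 rdt; set v := (- u.2, u.1).
have v1 : v.1 ^+ 2 + v.2 ^+ 2 = 1 by rewrite -u1 /=; ring.
(* In the frame with origin at the midpoint m and first axis u, the corners are (-d/2, 0) and (d/2,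
   0), and the lens has centres (0, -t/2) and (0, t/2). *)
pose m := along u (d / 2) p.
pose z := rigid m u (0, - (t / 2)).
exists (cball z r `&` cball (along v t z) r); split.
- by apply: measurableI; apply: measurable_cball.
- exact: measure_cballI.
have pE : p = rigid m u (- (d / 2), 0).
  by rewrite [LHS]surjective_pairing /m /along /rigid /=; congr pair; ring.
have qE : along u d p = rigid m u (d / 2, 0).
  by rewrite /m /along /rigid /=; congr pair; field.
have wE : along v t z = rigid m u (0, t / 2).
  by rewrite /along /z /v /rigid /=; congr pair; field.
move=> c; rewrite qE pE wE /z.
have [[C E] ->] := rigid_surj m c u1.
move=> h1 h2 x; have [[X Y] ->] := rigid_surj m x u1; move: h1 h2.
rewrite /setI /= -/(cball _ _ _) -/(cball _ _ _) !cball_rigid// /cball /=.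
move=> h1 h2 [h3 h4].
by apply: (@spindle_coord r t d) => //; nra.
Qed.

(* Each chord of B(c) in the direction u loses a piece of length at most d when
   the ball is translated by d u, and only chords meeting K matter. *)
Lemma mu_cball_shift (K : set (R * R)) c u r d D : measurable K ->
  K `<=` cball c r -> 0 <= d -> u.1 ^+ 2 + u.2 ^+ 2 = 1 -> 0 <= D ->
  (forall p q, K p -> K q -> enorm2 (vsub p q) <= D) ->
  (mu K <= mu (K `&` cball (along u d c) r) + (d * D)%:E)%E.
Proof.
move=> mK Kc d0 u1 D0 KD.
have [_ <-] := preserves_area_rigid c u1 mK.
have mI : measurable (K `&` cball (along u d c) r).
  by apply: measurableI => //; apply: measurable_cball.
have [mI' <-] := preserves_area_rigid c u1 mI.
have [mK' _] := preserves_area_rigid c u1 mK.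
set K' := rigid c u @^-1` K in mK' *.
set I := _ @^-1` _ in mI' *.
(* Heights of the chords that meet K. By the diameter bound they fill at most an interval of length
   D; if K is empty, [b] is a default value and [Yb] is vacuous. *)
pose Y := [set y : R | exists x, K' (x, y)].
pose b := sup Y.
have Yb y : Y y -> b - D <= y <= b.
  move=> [x Kxy].
  have ub y' : Y y' -> y' <= y + D.
    move=> [x' Kxy']; have := KD _ _ Kxy' Kxy.
    move=> hD; rewrite -lerBlDl (le_trans _ hD)// /enorm2 /vsub /rigid /=.
    have -> : (c.1 + u.1 * x' - u.2 * y' - (c.1 + u.1 * x - u.2 * y)) ^+ 2 +
      (c.2 + u.2 * x' + u.1 * y' - (c.2 + u.2 * x + u.1 * y)) ^+ 2 =
      (u.1 ^+ 2 + u.2 ^+ 2) * ((x' - x) ^+ 2 + (y' - y) ^+ 2) by ring.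
    by rewrite u1 mul1r (le_trans (ler_norm _))// -sqrtr_sqr ler_wsqrtr// lerDr sqr_ge0.
  apply/andP; split.
    rewrite lerBlDr; apply: ge_sup; first by exists y; exists x.
    exact: ub.
  apply: ub_le_sup; last by exists x.
  by exists (y + D).
have mh : measurable_fun setT (fun y : R => - Num.sqrt (r ^+ 2 - y ^+ 2)).
  by apply: measurableT_comp => //; exact: measurable_sqrt_disk.
(* The points within horizontal distance d of the left arc, at heights in [b - D, b]: they cover all
   that the shift removes from K. *)
have [mS] := measure_strip mh
  (measurable_itv `[0, d]) (measurable_itv `[b - D, b]).
set S := [set p | _] in mS *.
rewrite [X in (X * _)%E]lebesgue_measure_bounded_itv//.
rewrite [X in (_ * X)%E]lebesgue_measure_bounded_itv; last lra.
rewrite subr0 subKr -EFinM => muS.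
rewrite -muS; apply: le_trans (measureU2 _ _ _) => //.
apply: le_measure; rewrite ?inE//; first exact: measurableU.
move=> -[x y] Kxy.
have cE : c = rigid c u (0, 0).
  by rewrite [LHS]surjective_pairing /rigid /=; congr pair; ring.
have dE : along u d c = rigid c u (d, 0) by rewrite /along /rigid /=; congr pair; ring.
have Sy : b - D <= y <= b by apply: Yb; exists x.
have xr : cball (0, 0) r (x, y) by rewrite -(cball_rigid c _ _ _ u1) -cE; apply: Kc.
have [xd|xd] := leP ((x - d) ^+ 2 + (y - 0) ^+ 2) (r ^+ 2).
  by left; split => //; rewrite dE cball_rigid.
right; rewrite /S /= !in_itv/=; split => //; move: xr; rewrite /cball /= => xr.
have f0 := sqrtr_ge0 (r ^+ 2 - y ^+ 2).
have f2 : Num.sqrt (r ^+ 2 - y ^+ 2) ^+ 2 = r ^+ 2 - y ^+ 2.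
  by rewrite sqr_sqrtr//; nra.
set F := Num.sqrt _ in f0 f2 *.
rewrite !subr0 in xr xd.
have xF : `|x| <= F.
  rewrite -(ler_pXn2r (_ : 0 < 2)%N) ?nnegrE// real_normK ?num_real// f2; lra.
move: xF; rewrite ler_norml => /andP[xF1 xF2].
apply/andP; split; first lra.
by rewrite opprK leNgt; apply/negP => h; nra.
Qed.

End Step.

(** * Finite chains of disks compared with lenses *)

Section Chain.
Variable R : realType.
Notation mu := (@leb2 R).
Implicit Types (p q u : R * R) (r t d : R).

Lemma enorm2_ge0 p : 0 <= enorm2 p. Proof. exact: sqrtr_ge0. Qed.

Lemma sqr_enorm2 p : enorm2 p ^+ 2 = p.1 ^+ 2 + p.2 ^+ 2.
Proof. by rewrite sqr_sqrtr// addr_ge0// sqr_ge0. Qed.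

Lemma enorm2_le p r : 0 <= r -> (enorm2 p <= r) = (p.1 ^+ 2 + p.2 ^+ 2 <= r ^+ 2).
Proof. by move=> r0; rewrite -sqr_enorm2 ler_pXn2r// nnegrE ?enorm2_ge0. Qed.

Lemma enorm2_triangle p q : enorm2 (vadd p q) <= enorm2 p + enorm2 q.
Proof.
have p0 := enorm2_ge0 p; have q0 := enorm2_ge0 q.
rewrite enorm2_le ?addr_ge0// /vadd /=.
have CS : p.1 * q.1 + p.2 * q.2 <= enorm2 p * enorm2 q.
  rewrite (le_trans (ler_norm _))// -(ler_pXn2r (_ : 0 < 2)%N) ?nnegrE ?mulr_ge0//.
  rewrite real_normK ?num_real// exprMn !sqr_enorm2.
  have := sqr_ge0 (p.1 * q.2 - p.2 * q.1); nra.
by rewrite [leRHS]sqrrD !sqr_enorm2; nra.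
Qed.

Lemma enorm2_vsub_triangle p q c :
  enorm2 (vsub p q) <= enorm2 (vsub p c) + enorm2 (vsub q c).
Proof.
have -> : vsub p q = vadd (vsub p c) (vsub c q).
  by rewrite /vadd /vsub /=; congr pair; ring.
apply: le_trans (enorm2_triangle _ _) _; rewrite lerD2l le_eqVlt; apply/orP; left.
by apply/eqP; rewrite /enorm2 /vsub /=; congr Num.sqrt; ring.
Qed.

Lemma cballP c r p : 0 <= r -> cball c r p <-> enorm2 (vsub p c) <= r.
Proof. by move=> r0; rewrite enorm2_le. Qed.

(* [n] will absorb the error of replacing the diameter by the length of an
   almost longest chord. *)
Lemma lens_height_slack r T k : 0 < T -> T < 2 * r -> 0 < k ->
  exists d0 n, [/\ 0 < d0, 0 < n & forall d t, 0 <= d -> d <= d0 -> 0 <= t ->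
    t + (1 + k) * d <= T ->
    lens_height r t + n <= (1 + k) * lens_height r (t + (1 + k) * d)].
Proof.
move=> T0 Tr k0; set h := lens_height r.
have h2 t : 0 <= t -> t <= 2 * r -> h t ^+ 2 = 4 * r ^+ 2 - t ^+ 2.
  by move=> ? ?; rewrite sqr_sqrtr//; nra.
have hT : 0 < h T by rewrite sqrtr_gt0; nra.
have hT2 : h T ^+ 2 = 4 * r ^+ 2 - T ^+ 2 by apply: h2; lra.
have c0 : 0 < 2 * T * (1 + k) by rewrite !mulr_gt0//; lra.
(* With e = (1 + k) d, the first value gives 2 T e <= k (h T)^2, hence h t <= (1 + k / 2) h (t + e).
   The remaining k / 2 times h (t + e) covers the second value, as h T <= h (t + e). *)
exists (k * h T ^+ 2 / (2 * T * (1 + k))), (k * h T / 2).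
split; [by rewrite !mulr_gt0 ?invr_gt0|by rewrite !mulr_gt0 ?invr_gt0; lra|].
move=> d t d0; rewrite ler_pdivlMr// => dd t0.
set e := (1 + k) * d => teT.
have e0 : 0 <= e by rewrite mulr_ge0//; lra.
have eh : e * (2 * T) <= k * h T ^+ 2.
  by rewrite (_ : e * (2 * T) = d * (2 * T * (1 + k)))// /e; ring.
have h0 := sqrtr_ge0 (4 * r ^+ 2 - (t + e) ^+ 2); rewrite -/(lens_height _ _) -/h in h0.
have ht2 : h t ^+ 2 = 4 * r ^+ 2 - t ^+ 2 by apply: h2; lra.
have he2 : h (t + e) ^+ 2 = 4 * r ^+ 2 - (t + e) ^+ 2 by apply: h2; lra.
have hTe : h T <= h (t + e).
  rewrite -(ler_pXn2r (_ : 0 < 2)%N) ?nnegrE//; last lra.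
  by rewrite hT2 he2; nra.
suff : h t <= (1 + k / 2) * h (t + e) by nra.
rewrite -(ler_pXn2r (_ : 0 < 2)%N) ?nnegrE ?sqrtr_ge0//; last first.
  by rewrite mulr_ge0//; lra.
rewrite exprMn ht2.
have s1 : 4 * r ^+ 2 - t ^+ 2 <= h (t + e) ^+ 2 + e * (2 * T) by rewrite he2; nra.
have s2 : h T ^+ 2 <= h (t + e) ^+ 2 by rewrite hT2 he2; nra.
apply: le_trans s1 _.
have s3 : e * (2 * T) <= k * h (t + e) ^+ 2 by nra.
have -> : (1 + k / 2) ^+ 2 = 1 + k + k ^+ 2 / 4 by field.
have := sqr_ge0 (h (t + e)); nra.
Qed.

Definition ball_chain (c : nat -> R * R) r n : set (R * R) :=
  [set p | forall i, (i <= n)%N -> cball (c i) r p].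

Lemma ball_chain0 c r : ball_chain c r 0 = cball (c 0%N) r.
Proof.
apply/seteqP; split => p /=; first exact.
by move=> h i; rewrite leqn0 => /eqP ->.
Qed.

Lemma ball_chainS c r n :
  ball_chain c r n.+1 = ball_chain c r n `&` cball (c n.+1) r.
Proof.
apply/seteqP; split => p /=.
  by move=> h; split => [i ni|]; apply: h => //; apply: leqW.
by move=> [h1 h2] i; rewrite leq_eqVlt => /orP[/eqP->//|]; apply: h1.
Qed.

Lemma measurable_ball_chain c r n : measurable (ball_chain c r n).
Proof.
elim: n => [|n IHn]; first by rewrite ball_chain0; apply: measurable_cball.
by rewrite ball_chainS; apply: measurableI => //; apply: measurable_cball.
Qed.

(** A near maximiser of the distance replaces a true diameter, which would require compactness. *)
Lemma almost_diameter (K : set (R * R)) c r n : 0 <= r -> K `<=` cball c r ->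
  K !=set0 -> 0 < n -> exists p q, [/\ K p, K q, enorm2 (vsub p q) <= 2 * r &
    forall p' q', K p' -> K q' -> enorm2 (vsub p' q') <= enorm2 (vsub p q) + n].
Proof.
move=> r0 Kc [k Kk] n0.
have Kr p q : K p -> K q -> enorm2 (vsub p q) <= 2 * r.
  move=> /Kc/(cballP _ _ r0) pc /Kc/(cballP _ _ r0) qc.
  by apply: le_trans (enorm2_vsub_triangle _ _ c) _; lra.
pose E := [set enorm2 (vsub pq.1 pq.2) | pq in [set pq | K pq.1 /\ K pq.2]].
have hE : has_sup E.
  split; first by exists (enorm2 (vsub k k)); exists (k, k).
  by exists (2 * r) => _ [[p q] /= [Kp Kq] <-]; apply: Kr.
have [_ [[p q]/= [Kp Kq] <-] pqn] := sup_adherent n0 hE.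
exists p, q; split => //; first exact: Kr.
move=> p' q' Kp' Kq'; apply: (@le_trans _ _ (sup E)).
  by apply: ub_le_sup; [exact: hE.2|exists (p', q')].
by rewrite -lerBlDr ltW.
Qed.

(** Discrete form of the differential inequality, by induction on the number of moves. If D is the
    length of an almost longest chord of K and m is at most its [lens_height], one more disk costs K
    at most d (D + s) <= d (h m + s) <= e h (m + e), while the lens loses at least e h (m + e)
    between m and m + e. *)
Lemma mu_ball_chain (c : nat -> R * R) r T d e s n :
  0 < r -> T <= 2 * r -> 0 <= d -> 0 <= e -> 0 < s ->
  (forall t, 0 <= t -> t + e <= T ->
    d * (lens_height r t + s) <= e * lens_height r (t + e)) ->
  (forall i, (i < n)%N -> enorm2 (vsub (c i.+1) (c i)) <= d) ->
  n%:R * e <= T ->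
  (mu (lens r (n%:R * e)) <= mu (ball_chain c r n))%E.
Proof.
move=> r0 Tr d0 e0 s0 slack.
elim: n => [|n IHn] cd nT.
  have u1 : ((1 : R), (0 : R)).1 ^+ 2 + ((1 : R), (0 : R)).2 ^+ 2 = 1.
    by rewrite /=; ring.
  rewrite mul0r -(measure_cballI (c 0%N) r (lexx 0) u1) ball_chain0.
  rewrite /along !mul0r !addr0.
  by rewrite -surjective_pairing setIid.
have nE : n.+1%:R * e = n%:R * e + e by rewrite -natr1 mulrDl mul1r.
rewrite nE in nT *; set C := n%:R * e in IHn nT *.
have C0 : 0 <= C by rewrite mulr_ge0.
have {}IHn : (mu (lens r C) <= mu (ball_chain c r n))%E.
  by apply: IHn; [move=> i ni; apply: cd; exact: leqW|lra].
have mK := measurable_ball_chain c r n.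
set K := ball_chain c r n in IHn mK *.
have mK' : measurable (ball_chain c r n.+1) by exact: measurable_ball_chain.
have Kc i : (i <= n)%N -> K `<=` cball (c i) r by move=> ni p; apply.
(* An empty K has no chord; the induction hypothesis then makes the lenses null. *)
have [K0|/set0P Kn0] := eqVneq K set0.
  apply: (@le_trans _ _ (mu (lens r C))); first by apply: mu_lens_le => //; lra.
  by rewrite (le_trans IHn)// K0 /leb2 measure0.
have [q [p [Kq Kp]]] := almost_diameter (ltW r0) (Kc 0%N isT) Kn0 s0.
have [u [u1]] := polar (vsub q p).
have D0 := enorm2_ge0 (vsub q p); set D := enorm2 _ in D0 * => uE Dr Ds.
have qE : q = along u D p.
  by rewrite [LHS]surjective_pairing /along; case: uE => <- <-; congr pair; ring.
set t := lens_height r D.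
have t0 : 0 <= t := sqrtr_ge0 _.
have t2 : t ^+ 2 = 4 * r ^+ 2 - D ^+ 2 by rewrite sqr_sqrtr//; nra.
have mut : (mu (lens r t) <= mu K)%E.
  have [||||S [mS <- SK]] := @spindle _ u p D r t => //; first by rewrite t2; ring.
  apply: le_measure; rewrite ?inE// => x Sx i ni.
  by apply: SK Sx; [exact: Kp|rewrite -qE; exact: Kq].
(* Both lenses at t and at C have at most the area of K. The minimum gives D <= h m, from m <= t,
   and m + e <= C + e. *)
pose m := Num.min t C.
have mum : (mu (lens r m) <= mu K)%E.
  by rewrite /m; have [tC|Ct] := leP t C; [exact: mut|exact: IHn].
have m0 : 0 <= m by rewrite /m le_min t0.
have mC : m <= C by rewrite /m ge_min lexx orbT.
have mt : m <= t by rewrite /m ge_min lexx.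
have Dm : D <= lens_height r m.
  have Dm2 : D ^+ 2 <= 4 * r ^+ 2 - m ^+ 2 by clearbody m t; nra.
  have D2 := sqr_ge0 D.
  have Dm3 : 0 <= 4 * r ^+ 2 - m ^+ 2 by apply: le_trans Dm2.
  have h2 : lens_height r m ^+ 2 = 4 * r ^+ 2 - m ^+ 2 by rewrite sqr_sqrtr.
  by rewrite -(ler_pXn2r (_ : 0 < 2)%N) ?nnegrE ?sqrtr_ge0// h2.
have [v [v1]] := polar (vsub (c n.+1) (c n)).
have d'0 := enorm2_ge0 (vsub (c n.+1) (c n)).
have := cd n (ltnSn n); set d' := enorm2 _ in d'0 * => d'd vE.
have cE : c n.+1 = along v d' (c n).
  by rewrite [LHS]surjective_pairing /along; case: vE => <- <-; congr pair; ring.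
have Ds0 : 0 <= D + s by lra.
have := mu_cball_shift mK (Kc n (leqnn n)) d'0 v1 Ds0 Ds.
rewrite -cE -ball_chainS => shift.
have gap := @mu_lens_gap R r m e (ltW r0) m0 e0.
apply: (@le_trans _ _ (mu (lens r (m + e)))); first by apply: mu_lens_le; lra.
have dDs : d' * (D + s) <= e * lens_height r (m + e).
  apply: le_trans (slack m m0 _); last lra.
  by apply: ler_pM => //; lra.
rewrite -(leeD2rE (x := (e * lens_height r (m + e))%:E))//.
apply: le_trans (gap _) _; first lra.
apply: le_trans mum _; apply: le_trans shift _.
by rewrite leeD2l// lee_fin.
Qed.

End Chain.

(** * Paths *)

Section Escape.
Variable R : realType.
Notation mu := (@leb2 R).
Implicit Types (p q u : R * R) (r t d : R) (g : R -> R * R).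

(** A subdivision of [0, s] followed by the chord from s to t is a subdivision of [0, t], so s plus
    the length of the chord is at most t. *)
Lemma path_lipschitz g s t : is_path g -> 0 <= s -> s <= t ->
  enorm2 (vsub (g t) (g s)) <= t - s.
Proof.
move=> [_ _ len] s0; rewrite le_eqVlt => /orP[/eqP<-|st].
  by rewrite /enorm2 /vsub /= !subrr expr0n addr0 sqrtr0.
have append n (x : nat -> R) : x 0%N = 0 -> x n = s ->
    (forall i, (i < n)%N -> x i <= x i.+1) ->
    \sum_(i < n) enorm2 (vsub (g (x i.+1)) (g (x i))) <= t - enorm2 (vsub (g t) (g s)).
  move=> x0 xn xi; rewrite lerBrDr -lee_fin -(len t); last lra.
  apply: ereal_sup_ubound => /=.
  exists n.+1, (fun i => if (i <= n)%N then x i else t); split => //.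
  - by rewrite ltnn.
  - move=> i; rewrite ltnS => ni; rewrite ni; case: ltnP => h; first exact: xi.
    have -> : i = n by apply/eqP; rewrite eqn_leq ni h.
    by rewrite xn ltW.
  - congr (_%:E); rewrite big_ord_recr /= ltnn leqnn xn; congr (_ + _).
    by apply: eq_bigr => i _; rewrite ltn_ord (ltnW (ltn_ord i)).
suff : s <= t - enorm2 (vsub (g t) (g s)) by lra.
(* The length is prescribed at positive times only; at s = 0 the trivial subdivision does. *)
have [s00|sn0] := eqVneq s 0.
  have := append 0%N (fun=> 0); rewrite big_ord0 s00 => H; apply: H => //.
rewrite -lee_fin -(len s) ?lt_neqAle 1?eq_sym ?sn0//.
apply: ge_ereal_sup => _ [n [x [x0 xn xi ->]]].
by rewrite lee_fin; apply: append.
Qed.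

(** An inclusion of lenses, since (a + e)^2 >= a^2 + e^2 for a >= 0. *)
Lemma mu_lens_shrink r t e : 0 <= t -> 0 <= e -> r ^+ 2 + e ^+ 2 = 1 ->
  (mu (lens 1 (t + 2 * e)) <= mu (lens r t))%E.
Proof.
move=> t0 e0 re; apply: le_measure; rewrite ?inE; try (apply: measurable_lens; lra).
by move=> -[x y]; rewrite /lens /= expr1n; have := normr_ge0 x; nra.
Qed.

(** G is an intersection of disks of radius r < 1 centred at the points - g (i d), for sample times
    i d up to t. The gap t' - t pays for the discretisation. *)
Lemma escape_lower_set g t t' : is_path g -> 0 < t -> t < t' -> t' < 2 ->
  exists G, [/\ measurable G, G `<=` @disk R,
    (forall x, G x -> (t%:E <= escape_time g x)%E) &
    (mu (lens 1 t') <= mu G)%E].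
Proof.
move=> gp t0 tt' t'2.
(* Half of the gap goes to the slowing factor, (1 + k) t = T, and half to the smaller radius, T + 2
   e = t'. *)
pose T := t + (t' - t) / 2; pose e := (t' - t) / 4.
pose k := (t' - t) / (2 * t).
have kT : (1 + k) * t = T by rewrite /k /T; field; lra.
have k0 : 0 < k by rewrite divr_gt0//; lra.
pose r := Num.sqrt (1 - e ^+ 2).
have e0 : 0 < e by rewrite /e; lra.
have e1 : e < 1 / 2 by rewrite /e; lra.
have r2 : r ^+ 2 = 1 - e ^+ 2 by rewrite sqr_sqrtr//; nra.
have r0 : 0 < r by rewrite sqrtr_gt0; nra.
have r1 : r < 1 by nra.
have er : 1 - e <= r by nra.
have T0 : 0 < T by rewrite /T; lra.
have Tr : T < 2 * r by rewrite /T; rewrite /e in er; lra.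
have [d0 [s [d00 s0 slack]]] := lens_height_slack T0 Tr k0.
(* A step below [d0] gives the slack in heights; one below 1 - r keeps x + g inside the open disk
   between samples. *)
pose d1 := Num.min d0 ((1 - r) / 2).
have d10 : 0 < d1 by rewrite /d1 lt_min d00/=; lra.
pose n := (Num.truncn (t / d1)).+1.
pose d := t / n%:R.
have n0 : 0 < n%:R :> R by rewrite ltr0n.
have d_gt0 : 0 < d by rewrite divr_gt0.
have dd1 : d <= d1.
  by rewrite ler_pdivrMr// mulrC -ler_pdivrMr// ltW// truncnS_gt.
have dd0 : d <= d0 by rewrite (le_trans dd1)// /d1 ge_min lexx.
have dr : d < 1 - r.
  have : d1 <= (1 - r) / 2 by rewrite /d1 ge_min lexx orbT.
  lra.
have nd : n%:R * d = t by rewrite mulrC divfK// gt_eqF.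
pose c i : R * R := vsub (0, 0) (g (i%:R * d)).
have g0 : g 0 = (0, 0) by case: gp.
have cvsub p i : vsub p (c i) = vadd p (g (i%:R * d)).
  by rewrite /vsub /vadd /c /=; congr pair; ring.
exists (ball_chain c r n); split.
- exact: measurable_ball_chain.
- move=> p /(_ 0%N isT) /(cballP _ _ (ltW r0)).
  rewrite cvsub mul0r g0 /vadd !addr0 -surjective_pairing => pr.
  by rewrite /disk /=; lra.
- move=> x xG; apply: le_ereal_inf_tmp => _ [s' /= [s'0 xs'] <-].
  rewrite lee_fin leNgt; apply/negP => s't.
  apply: xs'; rewrite /open_disk /=.
  pose i := Num.truncn (s' / d).
  have sd0 : 0 <= s' / d by rewrite divr_ge0// ltW.
  have /andP[i1 i2] := truncn_itv sd0.
  have is' : i%:R * d <= s' by rewrite -ler_pdivlMr.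
  have s'i : s' < i%:R * d + d by rewrite ltr_pdivrMr// -natr1 mulrDl mul1r in i2.
  have ni : (i <= n)%N by rewrite -(ler_nat R) -(ler_pM2r d_gt0) nd; lra.
  have id0 : 0 <= i%:R * d by rewrite mulr_ge0// ltW.
  have /(cballP _ _ (ltW r0)) := xG i ni; rewrite cvsub => xi.
  have := path_lipschitz gp id0 is'.
  have := enorm2_triangle (vadd x (g (i%:R * d))) (vsub (g s') (g (i%:R * d))).
  have -> : vadd (vadd x (g (i%:R * d))) (vsub (g s') (g (i%:R * d))) = vadd x (g s').
    by rewrite /vadd /vsub /=; congr pair; ring.
  lra.
- apply: (@le_trans _ _ (mu (lens r T))).
    have -> : t' = T + 2 * e by rewrite /T /e; field.
    by apply: mu_lens_shrink; rewrite ?r2; lra.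
  have nT : n%:R * ((1 + k) * d) = T by rewrite mulrCA nd.
  rewrite -nT.
  apply: (@mu_ball_chain R c r T d _ s) => //; rewrite ?nT//; try lra.
  + by rewrite mulr_ge0//; lra.
  + move=> t1 t10 t1T; have := slack d t1 (ltW d_gt0) dd0 t10 t1T.
    by rewrite -(ler_pM2l d_gt0) mulrCA mulrA.
  + move=> i ni; rewrite cvsub.
    have -> : vadd (c i.+1) (g (i%:R * d)) = vsub (g (i%:R * d)) (g (i.+1%:R * d)).
      by rewrite /vadd /vsub /c /=; congr pair; ring.
    have : enorm2 (vsub (g (i.+1%:R * d)) (g (i%:R * d))) <= i.+1%:R * d - i%:R * d.
      apply: path_lipschitz => //; first by rewrite mulr_ge0// ltW.
      by rewrite ler_pM2r// ler_nat.
    rewrite -natr1 mulrDl mul1r (addrC _ d) addrK; apply: le_trans.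
    rewrite le_eqVlt; apply/orP; left; apply/eqP.
    by rewrite /enorm2 /vsub /=; congr Num.sqrt; ring.
Qed.

End Escape.

(** * Expected escape times *)

(* Unlike the library's ge0_le_integral, this needs no measurability, so that
   escape times need not be shown measurable. *)
Lemma ge0_le_integral_nomeas d (T : measurableType d) (R : realType)
  (m : {measure set T -> \bar R}) (D : set T) (f1 f2 : T -> \bar R) :
  (forall x, D x -> (0 <= f1 x)%E) -> (forall x, D x -> (f1 x <= f2 x)%E) ->
  (\int[m]_(x in D) f1 x <= \int[m]_(x in D) f2 x)%E.
Proof.
move=> f10 f12; rewrite !ge0_integralE//; last first.
  by move=> x Dx; apply: le_trans (f12 x Dx); apply: f10.
apply: le_ereal_sup => _ /= [h hf <-]; exists h => // x.
apply: le_trans (hf x) _; rewrite /patch; case: ifPn => // /set_mem; exact: f12.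
Qed.

Section Layers.
Context d (T : measurableType d) (R : realType) (m : {measure set T -> \bar R}).
Implicit Types (e : R) (G : nat -> set T).

Definition layers e G n x : \bar R :=
  (\sum_(j < n) (e%:E * (\1_(G j) x)%:E))%E.

Lemma layers_ge0 e G n x : 0 <= e -> (0 <= layers e G n x)%E.
Proof. by move=> e0; apply: sume_ge0 => j _; rewrite -EFinM lee_fin mulr_ge0. Qed.

Lemma integral_layers e G n (D : set T) : 0 <= e -> measurable D ->
  (forall j, (j < n)%N -> measurable (G j)) ->
  (forall j, (j < n)%N -> G j `<=` D) ->
  (\int[m]_(x in D) layers e G n x = \sum_(j < n) e%:E * m (G j))%E.
Proof.
move=> e0 mD mG GD.
have mI (j : 'I_n) : measurable_fun D (fun x => (\1_(G j) x)%:E : \bar R).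
  by apply/measurable_EFinP; apply: measurable_indic; exact: mG.
rewrite /layers ge0_integral_sum//.
- apply: eq_bigr => j _; rewrite ge0_integralZl_EFin//.
  by rewrite integral_indic ?setIidl//; [exact: GD|exact: mG].
- by move=> j; apply: emeasurable_funM.
- by move=> j x _; rewrite -EFinM lee_fin mulr_ge0.
Qed.

(** The sets need not be nested: if j is the last index with x in G j, at most j + 1 layers contain
    x. *)
Lemma layers_le e G n x (t : \bar R) : 0 <= e -> (0 <= t)%E ->
  (forall j, (j < n)%N -> G j x -> ((j.+1%:R * e)%:E <= t)%E) ->
  (layers e G n x <= t)%E.
Proof.
move=> e0 t0; elim: n => [|n IHn] hT; first by rewrite /layers big_ord0.
rewrite /layers big_ord_recr /= -/(layers e G n x) indicE.
have [/set_mem Gx|_] := boolP (x \in G n).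
  apply: le_trans (hT n (ltnSn n) Gx); rewrite mule1 -natr1 mulrDl mul1r EFinD leeD2r//.
  rewrite /layers; apply: (@le_trans _ _ (\sum_(j < n) e%:E)%E).
    apply: lee_sum => j _; rewrite -EFinM lee_fin indicE.
    by case: (_ \in _); rewrite ?mulr1 ?mulr0.
  by rewrite sumEFin lee_fin sumr_const card_ord mulr_natl.
by rewrite mule0 adde0; apply: IHn => j jn; apply: hT; exact: leqW.
Qed.

Lemma le_layers e G n x (t : \bar R) : 0 <= e ->
  (forall j, (j < n)%N -> ~ G j x -> (t <= (j%:R * e)%:E)%E) ->
  (t <= (n%:R * e)%:E)%E ->
  (t <= layers e G n x)%E.
Proof.
move=> e0 hT hn.
(* Until a first layer misses x, every layer contributes e; at that layer the bound is already
   reached. *)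
suff [//|nE] : (t <= layers e G n x)%E \/ layers e G n x = (n%:R * e)%:E by rewrite nE.
elim: n hT {hn} => [|n IHn] hT; first by right; rewrite /layers big_ord0 mul0r.
rewrite /layers big_ord_recr /= -/(layers e G n x).
have i0 : (0 <= e%:E * (\1_(G n) x)%:E)%E by rewrite -EFinM lee_fin mulr_ge0.
have [|tn|nE] := IHn; first by move=> j jn; apply: hT; exact: leqW.
  by left; apply: le_trans tn _; rewrite leeDl.
have [Gx|Gx] := pselect (G n x).
  by right; rewrite nE indicE mem_set// mule1 -EFinD -natr1 mulrDl mul1r.
by left; rewrite nE (le_trans (hT n (ltnSn n) Gx))// leeDl.
Qed.

End Layers.

(** * Riemann sums for the two integrals *)

Section MainInequality.
Variable R : realType.
Notation mu := (@leb2 R).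

Lemma mu_lens0_le4 : (mu (lens 1 0) <= 4%:E)%E.
Proof.
apply: (@le_trans _ _ (mu (`[-1, 1] `*` `[-1, 1]))).
  apply: le_measure; rewrite ?inE; [exact: measurable_lens|exact: measurableX|].
  move=> -[x y]; rewrite /lens /= !in_itv/= expr1n mul0r addr0 => h.
  have := normr_ge0 x; rewrite -ler_norml => x0.
  by split; [|apply/andP; split]; nra.
rewrite /leb2 product_measure1E//.
rewrite [X in (X * _)%E]lebesgue_measure_bounded_itv; last lra.
rewrite [X in (_ * X)%E]lebesgue_measure_bounded_itv; last lra.
by rewrite -EFinM lee_fin; lra.
Qed.

Lemma escape_time_ge0 (g : R -> R * R) x : (0 <= escape_time g x)%E.
Proof. by apply: le_ereal_inf_tmp => _ [t /= [t0 _] <-]; rewrite lee_fin. Qed.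

Lemma escape_time_le (g : R -> R * R) x t :
  0 <= t -> ~ open_disk (vadd x (g t)) -> (escape_time g x <= t%:E)%E.
Proof. by move=> t0 xt; apply: ereal_inf_lbound; exists t. Qed.

Lemma disk_cball : @disk R = cball (0, 0) 1.
Proof.
by apply/seteqP; split => -[x y]; rewrite /disk /cball /= enorm2_le//= !subr0.
Qed.

Lemma open_diskP (p : R * R) : open_disk p <-> p.1 ^+ 2 + p.2 ^+ 2 < 1.
Proof.
by rewrite /open_disk /= -sqr_enorm2; have := enorm2_ge0 p; split; nra.
Qed.

(** Upper sum: E j holds the points still in the closed disk at time j e, and all have escaped by
    time n e >= 2. *)
Lemma integral_straight_le u e n : enorm2 u = 1 -> 0 <= e -> 2 <= n%:R * e ->
  (\int[mu]_(x in @disk R) escape_time (straight_path u) x <=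
   \sum_(j < n) e%:E * mu (lens 1 (j%:R * e)))%E.
Proof.
move=> u1 e0 ne.
have u12 : (- u.1) ^+ 2 + (- u.2) ^+ 2 = 1 by rewrite !sqrrN -sqr_enorm2 u1 expr1n.
pose E j := cball (0, 0) 1 `&` cball (along (- u.1, - u.2) (j%:R * e) (0, 0)) 1.
have mE j : measurable (E j) by apply: measurableI; apply: measurable_cball.
have -> : (\sum_(j < n) e%:E * mu (lens 1 (j%:R * e)) = \sum_(j < n) e%:E * mu (E j))%E.
  by apply: eq_bigr => j _; rewrite measure_cballI// mulr_ge0.
have mD : measurable (@disk R) by rewrite disk_cball; exact: measurable_cball.
have <- : (\int[mu]_(x in @disk R) layers e E n x = \sum_(j < n) e%:E * mu (E j))%E.
  by apply: integral_layers => // j _; [exact: mE|rewrite disk_cball => x []].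
apply: ge0_le_integral_nomeas => x xD; first exact: escape_time_ge0.
apply: le_layers => //.
  move=> j jn xE; apply: escape_time_le; first by rewrite mulr_ge0.
  move=> /open_diskP; rewrite /vadd /straight_path /= => xo; apply: xE; split.
    by rewrite -disk_cball.
  by rewrite /cball /along /= expr1n !(add0r, mulrN, opprK) ltW.
apply: escape_time_le; first by rewrite mulr_ge0.
move=> /open_diskP; rewrite /vadd /straight_path /=.
move: xD; rewrite disk_cball /cball /= expr1n !subr0.
set t := n%:R * e in ne *; move: u12; rewrite !sqrrN => ab xy.
(* With c the component of x along u, |x + t u|^2 = (t + c)^2 + |x|^2 - c^2, which is at least 1 as
   t >= 2 and c >= -1. *)
pose c := x.1 * u.1 + x.2 * u.2.
have c2 : c ^+ 2 <= x.1 ^+ 2 + x.2 ^+ 2.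
  have -> : x.1 ^+ 2 + x.2 ^+ 2 = c ^+ 2 + (x.1 * u.2 - x.2 * u.1) ^+ 2.
    by rewrite -[LHS]mulr1 -ab /c; ring.
  by rewrite lerDl sqr_ge0.
have -> : (x.1 + t * u.1) ^+ 2 + (x.2 + t * u.2) ^+ 2 =
    x.1 ^+ 2 + x.2 ^+ 2 + 2 * t * c + t ^+ 2 * (u.1 ^+ 2 + u.2 ^+ 2).
  by rewrite /c; ring.
rewrite ab mulr1.
have c1 : - 1 <= c by rewrite leNgt; apply/negP => c1; nra.
have tc : 1 <= (t + c) ^+ 2 by rewrite expr_ge1//; lra.
have -> : x.1 ^+ 2 + x.2 ^+ 2 + 2 * t * c + t ^+ 2 =
  (t + c) ^+ 2 + (x.1 ^+ 2 + x.2 ^+ 2 - c ^+ 2) by ring.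
lra.
Qed.

(** Lower sum: layer j concerns escape after time (j + 1) e, and one further step e is the gap spent
    in [escape_lower_set]. Its times stay below 2 because j < n. *)
Lemma integral_path_ge (g : R -> R * R) e n : is_path g -> 0 < e ->
  n.+2%:R * e = 2 ->
  (\sum_(j < n) e%:E * mu (lens 1 (j.+2%:R * e)) <=
   \int[mu]_(x in @disk R) escape_time g x)%E.
Proof.
move=> gp e0 ne.
have mD : measurable (@disk R) by rewrite disk_cball; exact: measurable_cball.
have ex j : exists G, (j < n)%N -> [/\ measurable G, G `<=` @disk R,
    (forall x, G x -> ((j.+1%:R * e)%:E <= escape_time g x)%E) &
    (mu (lens 1 (j.+2%:R * e)) <= mu G)%E].
  have [jn|] := ltnP j n; last by exists set0.
  have [|||G GP] := @escape_lower_set R g (j.+1%:R * e) (j.+2%:R * e) gp.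
  - by rewrite mulr_gt0.
  - by rewrite ltr_pM2r// ltr_nat.
  - by rewrite -ne ltr_pM2r// ltr_nat !ltnS.
  by exists G.
have [G GP] := choice ex.
apply: (@le_trans _ _ (\sum_(j < n) e%:E * mu (G j))%E).
  apply: lee_sum => j _; apply: lee_wpmul2l; first by rewrite lee_fin ltW.
  by have [] := GP j (ltn_ord j).
have <- : (\int[mu]_(x in @disk R) layers e G n x = \sum_(j < n) e%:E * mu (G j))%E.
  by apply: integral_layers => //; [exact: ltW| |] => j jn; have [] := GP j jn.
apply: ge0_le_integral_nomeas => x xD; first by apply: layers_ge0; exact: ltW.
apply: layers_le; [exact: ltW|exact: escape_time_ge0|].
by move=> j jn; have [_ _ + _] := GP j jn; apply.
Qed.
End MainInequality.

Theorem theorem1 (R : realType) (g : R -> R * R) (u : R * R) :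
  is_path g -> enorm2 u = 1 ->
  (expected_escape (straight_path u) <= expected_escape g)%E.
Proof.
move=> gp u1; rewrite /expected_escape; apply: lee_wpmul2l.
  by rewrite lee_fin invr_ge0 pi_ge0.
apply/lee_addgt0Pr => d d0.
(* Chosen so that the final error 8 e = 16 / (n + 2) is at most d. *)
pose n := Num.truncn (16 / d).
pose e : R := 2 / n.+2%:R.
have n0 : 0 < n.+2%:R :> R by rewrite ltr0n.
have e0 : 0 < e by rewrite divr_gt0.
have ne : n.+2%:R * e = 2 by rewrite mulrC divfK// gt_eqF.
have ed : e * 8 <= d.
  have := truncnS_gt (16 / d); rewrite -/n ltr_pdivrMr// => h.
  rewrite -(ler_pM2l n0) mulrA ne.
  have : n.+1%:R <= n.+2%:R :> R by rewrite ler_nat.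
  nra.
clearbody e.
apply: le_trans (@integral_straight_le R u e n.+2 u1 (ltW e0) _) _; first by rewrite ne.
(* Without its first two terms the upper sum is exactly the lower sum; each of these two is at most
   4 e. *)
rewrite !big_ord_recl /= addeA addeC; apply: leeD.
  exact: integral_path_ge.
have bnd t : 0 <= t -> (e%:E * leb2 (lens 1 t) <= (e * 4)%:E)%E.
move=> t0; rewrite EFinM.
apply: lee_wpmul2l; first by rewrite lee_fin ltW.
  by apply: le_trans (mu_lens0_le4 R); apply: mu_lens_le.
apply: le_trans (_ : (e * 4)%:E + (e * 4)%:E <= _)%E; first last.
  by rewrite -EFinD lee_fin; lra.
by apply: leeD; apply: bnd; rewrite mulr_ge0// ltW.
Qed.
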